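(* Let $G_1=(V_1,\mathcal E_1)$ be a finite connected oriented graph with distinguished vertices $a_1,b_1$ such that $d_1(a_1,b_1)>1$ and there exist at least two edge-disjoint paths connecting $a_1$ to $b_1$ in $G_1$. Let $p_\star$ be the unique fixed point of $f_1$ in $(0,1)$. Then there exist constants $d_f$ and $c,C>0$ such that for every $k$ $$c\,d_f^k\le \mathbb E^k_{p_\star}\big[|\mathcal C_{\{a_k,b_k\}}|\big]\le C\,d_f^k .$$ Moreover, $d_f$ satisfies (a) $d_f<|\mathcal E_1|$; (b) $d_f>\max\{\deg^{\mathrm{out}}(a_1),\ \deg^{\mathrm{in}}(b_1),\ \min\{\deg(a_1),\deg(b_1)\}\}$. As a consequence, if $E_k$ denotes a uniformly selected edge of $G_k$ (independent of the percolation), then for every $k$ $$c\,d_k(a_k,b_k)^{-\alpha_1}\le \mathbb P^k_{p_\star}\big(E_k\leftrightarrow\{a_k,b_k\}\big)\le C\,d_k(a_k,b_k)^{-\alpha_1},$$ where $\alpha_1=\log(|\mathcal E_1|/d_f)/\log d_1(a_1,b_1)$.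
   Context: $G_1=(V_1,\mathcal E_1)$ is a finite connected oriented graph (a finite simple graph with an orientation chosen for each edge), with two distinguished vertices $a_1,b_1$. Distances, paths and connectivity ignore orientation. $d_k$ is the graph distance in $G_k$; $\deg^{\mathrm{out}},\deg^{\mathrm{in}}$ are out- and in-degrees in $G_1$ and $\deg=\deg^{\mathrm{out}}+\deg^{\mathrm{in}}$. Hierarchical graphs: $G_0$ is a single oriented edge $(a_0,b_0)$. Given $G_k=(V_k,\mathcal E_k)$ with distinguished vertices $a_k,b_k$, $G_{k+1}$ is obtained by replacing each oriented edge $(x,y)\in\mathcal E_k$ by a fresh copy of $G_1$, with $a_1$ identified with $x$ and $b_1$ with $y$; $a_{k+1},b_{k+1}$ are the vertices that were $a_k,b_k$. Percolation: under $\mathbb P^k_p$ (expectation $\mathbb E^k_p$) each edge of $G_k$ is independently open with probability $p$ and closed otherwise. $f_1(p)=\mathbb P^1_p(a_1\leftrightarrow b_1)$; under the stated hypothesis $f_1$ has exactly one fixed point $p_\star$ in $(0,1)$. For an edge $e$, $e\leftrightarrow\{a_k,b_k\}$ means that at least one endvertex of $e$ is connected by an open path (possibly of length zero) to $a_k$ or $b_k$; $e$ itself need not be open. $\mathcal C_{\{a_k,b_k\}}=\{e\in\mathcal E_k: e\leftrightarrow\{a_k,b_k\}\}$. *)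

(* Defs.v *)
From mathcomp Require Import all_boot all_order all_algebra.
From mathcomp Require Import reals exp.

Set Implicit Arguments.
Unset Strict Implicit.
Unset Printing Implicit Defensive.

Import Order.TTheory GRing.Theory Num.Theory.

Local Open Scope ring_scope.

(* The graphs G_k carry an explicit edge type. Simplicity is a separate
   predicate, assumed of G_1 only. *)
Record ograph := OGraph {
  vert : finType;
  edge : finType;
  src : edge -> vert;
  tgt : edge -> vert;
  pta : vert;
  ptb : vert
}.

Section Graph.
Variable G : ograph.
Implicit Types (x y : vert G) (e : edge G) (w : {set edge G}).

Definition oriented_simple : Prop :=
  (forall e, src e != tgt e) /\
  injective (fun e => [set src e; tgt e]).

Definition deg_out x : nat := #|[set e | src e == x]|.
Definition deg_in x : nat := #|[set e | tgt e == x]|.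
Definition deg x : nat := (deg_out x + deg_in x)%N.

Definition joins e x y : bool :=
  ((src e == x) && (tgt e == y)) || ((src e == y) && (tgt e == x)).

Definition adj w : rel (vert G) := [rel x y | [exists e in w, joins e x y]].

Definition graph_connected : Prop := forall x y, connect (adj setT) x y.

Definition has_walk x y (n : nat) : bool :=
  [exists s : n.-tuple (vert G), path (adj setT) x s && (last x s == y)].

(* [find] returns the least n < #|vert G| such that there is a walk with n
   edges from x to y; a shortest walk has fewer than #|vert G| edges. The value
   is #|vert G| when x and y are not connected. *)
Definition gdist x y : nat := find (has_walk x y) (iota 0 #|vert G|).

(* A walk from x records each traversed edge with the vertex it leads to. *)
Fixpoint walk x (s : seq (edge G * vert G)) : bool :=
  if s is (e, y) :: s' then joins e x y && walk y s' else true.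

Definition gpath x y (s : seq (edge G * vert G)) : bool :=
  [&& walk x s, last x (unzip2 s) == y & uniq (x :: unzip2 s)].

(* For x != y the two paths are nonempty, hence distinct. *)
Definition two_edge_disjoint_paths x y : Prop :=
  exists s1 s2 : seq (edge G * vert G),
    [/\ gpath x y s1, gpath x y s2 & ~~ has (mem (unzip1 s1)) (unzip1 s2)].

(* [w] is the set of open edges. *)
Definition linked w e : bool :=
  [exists x in [set src e; tgt e],
     [exists z in [set pta G; ptb G], connect (adj w) x z]].

Definition cluster w : {set edge G} := [set e | linked w e].

Section Percolation.
Variables (R : realType) (p : R).

Definition weight w : R := \prod_(e : edge G) (if e \in w then p else 1 - p).

Definition perc_prob (A : pred {set edge G}) : R := \sum_(w | A w) weight w.

Definition perc_expect (X : {set edge G} -> R) : R :=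
  \sum_(w : {set edge G}) weight w * X w.

(* The law of (uniform edge, configuration) is the product law. *)
Definition edge_perc_prob (A : pred (edge G * {set edge G})) : R :=
  \sum_(ew | A ew) (#|edge G|%:R)^-1 * weight ew.2.

Definition cross_prob : R :=
  perc_prob (fun w => connect (adj w) (pta G) (ptb G)).

Definition mean_cluster : R := perc_expect (fun w => #|cluster w|%:R).

Definition unif_linked_prob : R :=
  edge_perc_prob (fun ew => linked ew.2 ew.1).

End Percolation.
End Graph.

Definition single_edge : ograph :=
  @OGraph bool unit (fun=> false) (fun=> true) false true.

Section Substitution.
Variables G H : ograph.

Definition inner : finType := {v : vert H | (v != pta H) && (v != ptb H)}.

Definition subst_vert : finType := (vert G + edge G * inner)%type.

(* The vertex v in the copy of H replacing the edge e: [insub v] is [Some]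
   exactly when v is neither pta H nor ptb H. *)
Definition copy_vert (e : edge G) (v : vert H) : subst_vert :=
  if (insub v : option inner) is Some u then inr (e, u)
  else if v == pta H then inl (src e) else inl (tgt e).

Definition subst_graph : ograph :=
  @OGraph subst_vert (edge G * edge H)%type
    (fun ef => copy_vert ef.1 (src ef.2))
    (fun ef => copy_vert ef.1 (tgt ef.2))
    (inl (pta G)) (inl (ptb G)).

End Substitution.

Fixpoint hier (G1 : ograph) (k : nat) : ograph :=
  if k is k'.+1 then subst_graph (hier G1 k') G1 else single_edge.

(* Main.v *)
Require Import Defs.
From mathcomp Require Import all_boot all_order all_algebra.
From mathcomp Require Import reals exp.
From mathcomp Require Import zify ring.

Set Implicit Arguments.
Unset Strict Implicit.
Unset Printing Implicit Defensive.

Import Order.TTheory GRing.Theory Num.Theory.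

Local Open Scope ring_scope.

(** The growth of the cluster is that of a multitype branching process. Look at
    an edge of G_k and record which of its two ends are joined to a pole by open
    paths that avoid the edge itself: this subset of {source, target} is the
    type of the edge. When the edge is replaced by a copy of G_1, an edge f of
    the copy is joined to the poles of the large graph exactly when it is
    joined, inside the copy, to the ends recorded in the type
    ([anchored_subst]), with f itself left out on both sides. The
    type of an edge does not depend on its own state, so the copy is independent
    of it; and a copy connects its two poles with probability p_star, so the
    coarse configuration again has parameter p_star ([perc_subst]). Hence the
    mean numbers of edges of each type evolve by iterating one nonnegative
    linear operator, [transfer], on functions of the type ([transfer_hier]), and the
    mean cluster size U_k is obtained by applying its k-th power to the
    indicator [seen] of the nonempty types.

    Counting from both poles is submultiplicative, U_(j+k) <= U_j U_k, since
    every nonempty type has at most the descendants of the full type. Conversely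
    a single marked end has at least a fixed fraction delta of them
    ([mean_seen_isotropy]): if G_1 is entirely open, then some edge f of it is
    joined at both ends to the marked pole without using f, because f lies on a
    closed trail made of two edge-disjoint paths between the poles
    ([far_edge]). Thus U_(j+k) >= delta U_j U_k, and a Fekete argument
    ([quasi_multiplicative_rate]) gives a rate d with
    d^k <= U_k <= d^k / delta.

    The upper bound on d comes from U_2 < |E_1|^2: with everything closed, an
    edge having exactly one end at a pole produces edges that are not linked
    ([mean_seen2_lt]). The lower bound comes from the one-step inequality
    [mean_seen_step]: out-edges of a pole inherit the pole as their source,
    in-edges inherit it as their target, and [far_edge] supplies an additional
    edge, away from that pole, which makes the inequality strict.

    Finally d_k(a_k, b_k) = d_1(a_1, b_1)^k ([gdist_hier]): a 1-Lipschitz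
    potential on G_k extends over the copies of G_1 by interpolation, and a
    1-Lipschitz function is a lower bound for distances. *)

(** * Ends of edges and connections *)

(** Indexing the two ends of an edge and the two poles by booleans makes every
    statement about a and b symmetric. *)
Definition endp (G : ograph) (e : edge G) (i : bool) : vert G :=
  if i then tgt e else src e.

Definition pole (G : ograph) (i : bool) : vert G :=
  if i then ptb G else pta G.

(** Applied with e removed from w, this is the type of e; it is then a function
    of the other edges only, hence independent of the state of e. *)
Definition anchored (G : ograph) (S : {set bool}) (w : {set edge G})
    (e : edge G) : {set bool} :=
  [set i | [exists j in S, connect (adj w) (endp e i) (pole G j)]].

Lemma bool_neq (i j : bool) : i != j -> j = ~~ i.
Proof. by case: i; case: j. Qed.

Lemma setD1_id (T : finType) (A : {set T}) x : x \notin A -> A :\ x = A.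
Proof. by move=> xNA; apply/setDidPl; rewrite disjoint_sym disjoints1. Qed.

Section Graphs.
Variable G : ograph.
Implicit Types (x y z : vert G) (e f : edge G) (v w : {set edge G}).
Implicit Types (S : {set bool}) (i j : bool).

Lemma joinsP e x y :
  reflect (exists i, x = endp e i /\ y = endp e (~~ i)) (joins e x y).
Proof.
apply: (iffP orP) => [[] /andP[/eqP <- /eqP <-]|[[] [-> ->]]].
- by exists false.
- by exists true.
- by right; rewrite !eqxx.
- by left; rewrite !eqxx.
Qed.

Lemma joins_endp e i : joins e (endp e i) (endp e (~~ i)).
Proof. by apply/joinsP; exists i. Qed.

Lemma adjP w x y : reflect (exists2 e, e \in w & joins e x y) (adj w x y).
Proof. exact: exists_inP. Qed.

Lemma adj_sym w : symmetric (adj w).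
Proof.
by move=> x y; apply/adjP/adjP => -[e ew je]; exists e; rewrite // /joins orbC.
Qed.

Lemma connectC w x y : connect (adj w) x y = connect (adj w) y x.
Proof. exact/sym_connect_sym/adj_sym. Qed.

Lemma connect_endp w e i j : e \in w -> connect (adj w) (endp e i) (endp e j).
Proof.
move=> ew; have [->|] := eqVneq i j; first exact: connect0.
move=> /bool_neq ->; apply: connect1; apply/adjP; exists e => //.
exact: joins_endp.
Qed.

Lemma connect_subset v w x y :
  v \subset w -> connect (adj v) x y -> connect (adj w) x y.
Proof.
move=> /subsetP vw; apply: connect_sub => {}x {}y /adjP[e ev je].
by apply: connect1; apply/adjP; exists e => //; apply: vw.
Qed.

(** Follow a path from its last passage through e on. *)
Lemma connect_setD1 w e x z : connect (adj w) x z ->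
  connect (adj (w :\ e)) x z \/
  exists i, connect (adj (w :\ e)) (endp e i) z.
Proof.
case/connectP=> p + ->; elim: p x => [|y p IHp] x /=.
  by left; apply: connect0.
case/andP=> /adjP[f fw jf] /IHp[yz|]; last by right.
have [fe|f_neq_e] := eqVneq f e.
  by right; have [i [_ y_end]] := joinsP _ _ _ jf; exists (~~ i);
     rewrite -fe -y_end fe.
left; apply: connect_trans yz; apply: connect1; apply/adjP; exists f => //.
by rewrite in_setD1 f_neq_e.
Qed.

Lemma anchoredP S w e i :
  reflect (exists2 j, j \in S & connect (adj w) (endp e i) (pole G j))
          (i \in anchored S w e).
Proof. by rewrite inE; apply: exists_inP. Qed.

Lemma anchored0 w e : anchored set0 w e = set0.
Proof.
by apply/setP => i; rewrite in_set0; apply/anchoredP => -[j]; rewrite in_set0.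
Qed.

Lemma anchoredS S1 S2 w e :
  S1 \subset S2 -> anchored S1 w e \subset anchored S2 w e.
Proof.
move=> /subsetP S12; apply/subsetP=> i /anchoredP[j jS ij].
by apply/anchoredP; exists j => //; apply: S12.
Qed.

(** Whether an edge is linked does not depend on its own state. *)
Lemma linkedE w e : linked w e = (anchored setT (w :\ e) e != set0).
Proof.
apply/idP/set0Pn => [/exists_inP[x x_end /exists_inP[z z_pole xz]]|[i]].
  have {x_end}[i0 xE] : exists i, x = endp e i.
    by case/set2P: x_end => ->; [exists false|exists true].
  have {z_pole}[j zE] : exists j, z = pole G j.
    by case/set2P: z_pole => ->; [exists false|exists true].
  suff [i iz] : exists i, connect (adj (w :\ e)) (endp e i) z.
    by exists i; apply/anchoredP; exists j; rewrite -?zE ?in_setT.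
  by case: (connect_setD1 e xz) => //; exists i0; rewrite -xE.
case/anchoredP=> j _ ij; apply/exists_inP; exists (endp e i).
  by case: i {ij}; rewrite !inE eqxx ?orbT.
apply/exists_inP; exists (pole G j).
  by case: j {ij}; rewrite !inE eqxx ?orbT.
by apply: connect_subset ij; apply: subsetDl.
Qed.

End Graphs.

(** * Percolation on a substituted graph *)

Section Gluing.
Variables G H : ograph.
Hypothesis poles_neq : pta H != ptb H.
Implicit Types (e : edge G) (f : edge H) (W : {set edge (subst_graph G H)}).

Definition fiber W e : {set edge H} := [set f | (e, f) \in W].

Definition coarse W : {set edge G} :=
  [set e | connect (adj (fiber W e)) (pta H) (ptb H)].

Lemma copy_vert_pole e i :
  copy_vert e (pole H i) = inl (endp e i) :> subst_vert G H.
Proof.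
rewrite /copy_vert insubF; last by case: i => /=; rewrite eqxx ?andbF.
by case: i => /=; rewrite ?eqxx // eq_sym (negPf poles_neq).
Qed.

Lemma endp_subst e f i :
  endp ((e, f) : edge (subst_graph G H)) i = copy_vert e (endp f i).
Proof. by case: i. Qed.

Lemma copy_vert_inner e (u : inner H) :
  copy_vert e (val u) = inr (e, u) :> subst_vert G H.
Proof. by rewrite /copy_vert valK. Qed.

Lemma innerP v : (exists u : inner H, v = val u) \/ (exists i, v = pole H i).
Proof.
have [inner_v|] := boolP ((v != pta H) && (v != ptb H)).
  by left; exists (Sub v inner_v).
by rewrite negb_and !negbK => /orP[]/eqP->; right; [exists false|exists true].
Qed.

Lemma connect_copy W e (v v' : vert H) : connect (adj (fiber W e)) v v' ->
  connect (adj W) (copy_vert e v) (copy_vert e v').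
Proof.
case/connectP=> p + ->; elim: p v => [|y p IHp] v /=; first by rewrite connect0.
case/andP=> /adjP[f]; rewrite inE => fW /joinsP[i [-> ->]] /IHp.
apply: connect_trans; apply: connect1; apply/adjP; exists (e, f) => //.
by apply/joinsP; exists i; rewrite !endp_subst.
Qed.

Lemma coarseP W e i :
  reflect (connect (adj (fiber W e)) (pole H i) (pole H (~~ i)))
          (e \in coarse W).
Proof. by rewrite inE; case: i => /=; [rewrite connectC|]; apply: idP. Qed.

Lemma connect_coarse W (x y : vert G) : connect (adj (coarse W)) x y ->
  connect (adj W) (inl x) (inl y).
Proof.
case/connectP=> p + ->; elim: p x => [|z p IHp] x /=; first by rewrite connect0.
case/andP=> /adjP[e eW /joinsP[i [-> ->]]] /IHp; apply: connect_trans.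
by rewrite -!copy_vert_pole; apply: connect_copy; apply/coarseP.
Qed.

(** From a vertex v of the copy of e one reaches z by going to one of the poles
    of the copy inside it, and from there along coarse edges. *)
Definition exits W (z : vert G) e (v : vert H) : bool :=
  [exists i, connect (adj (fiber W e)) v (pole H i) &&
             connect (adj (coarse W)) (endp e i) z].

(** A description of the open cluster of z in the substituted graph in terms of
    the coarse configuration and of the fibers; it is shown to be closed under
    open edges. *)
Definition reach W z (v : subst_vert G H) : bool :=
  match v with
  | inl x => connect (adj (coarse W)) x z
  | inr (e, u) => exits W z e (val u)
  end.

Lemma reach_copy W z e v : reach W z (copy_vert e v) = exits W z e v.
Proof.
have [[u ->]|[i ->]] := innerP v; first by rewrite copy_vert_inner.
rewrite copy_vert_pole /=.
apply/idP/existsP => [iz|[j /andP[ij]]]; first by exists i; rewrite connect0.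
apply: connect_trans; have [->|] := eqVneq i j; first exact: connect0.
by move=> /bool_neq jE; apply: connect_endp; apply/(coarseP _ _ i); rewrite -jE.
Qed.

Lemma connect_substP W z e v :
  connect (adj W) (copy_vert e v) (inl z) = exits W z e v.
Proof.
apply/idP/idP => [|/existsP[i /andP[vi iz]]]; last first.
  apply: connect_trans (connect_copy vi) _; rewrite copy_vert_pole.
  exact: connect_coarse.
rewrite -reach_copy => /connectP[p + zE].
have: reach W z (last (copy_vert e v) p) by rewrite -zE /= connect0.
elim: p (copy_vert e v : subst_vert G H) {zE} => [|y p IHp] x //=.
move=> /IHp reach_y /andP[/adjP[[e' f] fW]] /joinsP[i [-> yE]] /reach_y.
rewrite yE !endp_subst !reach_copy => /existsP[j /andP[fj jz]].
apply/existsP; exists j; rewrite jz andbT; apply: connect_trans fj.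
by apply: connect_endp; rewrite inE.
Qed.

Lemma fiber_setD1 W e f e' :
  fiber (W :\ (e, f)) e' = if e' == e then fiber W e :\ f else fiber W e'.
Proof.
apply/setP => f'; rewrite !inE xpair_eqE.
by case: eqVneq => [->|_]; rewrite !inE.
Qed.

Lemma coarse_setD1 W e f : coarse (W :\ (e, f)) :\ e = coarse W :\ e.
Proof.
by apply/setP => e'; rewrite !inE fiber_setD1; case: eqVneq.
Qed.

(** The type of an edge (e, f) is computed inside the copy of e from the type of
    e. A coarse path may use e itself, but only if the poles of the copy are
    connected without f; one may then start from the last end of e that it
    visits. *)
Lemma anchored_subst S W e f :
  anchored S (W :\ (e, f)) (e, f) =
  anchored (anchored S (coarse W :\ e) e) (fiber W e :\ f) f.
Proof.
set W' := W :\ (e, f); rewrite -(coarse_setD1 W e f) -/W'.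
have -> : fiber W e :\ f = fiber W' e by rewrite fiber_setD1 eqxx.
have poleE j : pole (subst_graph G H) j = inl (pole G j) by case: j.
apply/setP => i; apply/anchoredP/anchoredP => -[j jS].
  rewrite endp_subst poleE connect_substP.
  case/existsP=> i1 /andP[fi1 i1j].
  have [i1j'|[i2 i2j]] := connect_setD1 e i1j.
    by exists i1 => //; apply/anchoredP; exists j.
  have i2_in : i2 \in anchored S (coarse W' :\ e) e.
    by apply/anchoredP; exists j.
  have [eW|eNW] := boolP (e \in coarse W'); last first.
    exists i1 => //; apply/anchoredP; exists j => //.
    by rewrite setD1_id.
  exists i2 => //; apply: connect_trans fi1 _.
  have [->|] := eqVneq i1 i2; first exact: connect0.
  by move=> /bool_neq ->; apply/coarseP.
move=> fj; case/anchoredP: jS => j' j'S jj'; exists j' => //.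
rewrite endp_subst poleE connect_substP; apply/existsP; exists j; rewrite fj /=.
by apply: connect_subset jj'; apply: subsetDl.
Qed.

End Gluing.

(** * Independence of the copies *)

Section Measure.
Variables (R : realType) (G : ograph).
Implicit Types (p : R) (w : {set edge G}).

Lemma weight_ge0 p w : 0 < p < 1 -> 0 <= weight p w.
Proof.
case/andP=> p_gt0 p_lt1; apply: prodr_ge0 => e _.
by case: ifP => _; rewrite ?subr_ge0 ltW.
Qed.

Lemma weight_gt0 p w : 0 < p < 1 -> 0 < weight p w.
Proof.
case/andP=> p_gt0 p_lt1; apply: prodr_gt0 => e _.
by case: ifP => _; rewrite ?subr_gt0.
Qed.

Lemma sum_weight p : \sum_(w : {set edge G}) weight p w = 1.
Proof.
rewrite /weight -(bigA_distr _ _ (fun=> p) (fun=> 1 - p)).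
by apply: big1 => e _; rewrite /= addrC subrK.
Qed.

Lemma sum_weightD1 p e (w0 : {set edge G}) : e \notin w0 ->
  \sum_(w : {set edge G} | w :\ e == w0) weight p w =
  \prod_(e' | e' != e) (if e' \in w0 then p else 1 - p).
Proof.
move=> eNw0.
rewrite (bigD1 w0) /=; last by rewrite setD1_id.
rewrite (big_pred1 (e |: w0)) => [|w] /=; last first.
  apply/andP/eqP => [[/eqP wE w_neq]|->].
    rewrite -wE setD1K //; apply: contraR w_neq => eNw.
    by rewrite -wE setD1_id.
  split; first by rewrite setU1K.
  by apply: contraNneq eNw0 => <-; rewrite setU11.
rewrite /weight (bigD1 e) //= [X in _ + X](bigD1 e) //= (negPf eNw0) setU11.
have -> : \prod_(i | i != e) (if i \in e |: w0 then p else 1 - p) =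
          \prod_(i | i != e) (if i \in w0 then p else 1 - p).
  by apply: eq_bigr => i i_neq; rewrite in_setU1 (negPf i_neq).
by rewrite -mulrDl subrK mul1r.
Qed.

End Measure.

Section GluingMeasure.
Variables (R : realType) (G H : ograph) (p : R).
Local Notation q := (cross_prob H p).

Lemma weight_subst (W : {set edge (subst_graph G H)}) :
  weight p W = \prod_e weight p (fiber W e).
Proof.
rewrite /weight pair_bigA /=; apply: eq_bigr => -[e f] _ /=.
by rewrite inE.
Qed.

(** The fibers are independent: an event that constrains each fiber separately
    has product probability. *)
Lemma sum_subst (P : {set edge (subst_graph G H)} -> bool)
    (Q : edge G -> pred {set edge H}) :
  (forall W, P W = [forall e, Q e (fiber W e)]) ->
  \sum_(W | P W) weight p W =
  \prod_e \sum_(w | Q e w) weight p w.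
Proof.
move=> PE; rewrite bigA_distr_big_dep.
pose h (g : {ffun edge G -> {set edge H}}) : {set edge (subst_graph G H)} :=
  [set ef | ef.2 \in g ef.1].
pose h' (W : {set edge (subst_graph G H)}) := [ffun e => fiber W e].
have fiber_h g e : fiber (h g) e = g e by apply/setP => f; rewrite !inE.
rewrite (reindex_onto h h') => [|W _]; last first.
  by apply/setP => -[e f]; rewrite !inE ffunE inE.
apply: eq_big => [g|g _].
  have -> : h' (h g) == g by apply/eqP/ffunP => e; rewrite ffunE fiber_h.
  rewrite andbT PE; apply/forallP/familyP => Qg e; move: (Qg e);
  by rewrite ?fiber_h.
by rewrite weight_subst; apply: eq_bigr => e _; rewrite fiber_h.
Qed.

(** The fiber over e is independent of the coarse state of the other edges, and
    the coarse configuration is percolation with parameter q. On the right the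
    state of e in w' is discarded, so it can be averaged out. *)
Lemma perc_subst e (F : {set edge H} -> {set edge G} -> R) :
  \sum_(W : {set edge (subst_graph G H)})
    weight p W * F (fiber W e) (coarse W :\ e) =
  \sum_(w' : {set edge G}) weight q w' *
    \sum_(w : {set edge H}) weight p w * F w (w' :\ e).
Proof.
pose X (W : {set edge (subst_graph G H)}) := (fiber W e, coarse W :\ e).
rewrite (partition_big X xpredT) //=.
rewrite (partition_big (fun w' : {set edge G} => w' :\ e) xpredT) //=.
transitivity (\sum_w0 \sum_w \sum_(W | X W == (w, w0)) weight p W * F w w0).
  rewrite exchange_big pair_bigA /=; apply: eq_bigr => -[w w0] _ /=.
  by apply: eq_bigr => W; rewrite xpair_eqE => /andP[/eqP-> /eqP->].
apply: eq_bigr => w0 _.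
transitivity (\sum_(w' : {set edge G} | w' :\ e == w0) weight q w' *
    \sum_(w : {set edge H}) weight p w * F w w0); last first.
  by apply: eq_bigr => w' /eqP ->.
rewrite -mulr_suml mulr_sumr; apply: eq_bigr => w _.
rewrite -mulr_suml mulrA; congr (_ * _).
have [ew0|eNw0] := boolP (e \in w0).
  rewrite !big_pred0 ?mul0r // => [w'|W].
    by apply: contraTF ew0 => /eqP <-; rewrite setD11.
  by apply: contraTF ew0 => /eqP[_ <-]; rewrite setD11.
rewrite sum_weightD1 //.
(* The event X W = (w, w0), split into one condition on each fiber. *)
pose Q e' (v : {set edge H}) := if e' == e then v == w else
  connect (adj v) (pta H) (ptb H) == (e' \in w0).
rewrite (@sum_subst _ Q) => [|W]; last first.
  rewrite xpair_eqE; apply/andP/forallP => [[/eqP wE /eqP w0E] e'|QW].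
    rewrite /Q -w0E !inE; case: (eqVneq e' e) => [->|_] //=.
    by rewrite wE.
  split; first by have := QW e; rewrite /Q eqxx.
  apply/eqP/setP => e'; rewrite !inE; have := QW e'; rewrite /Q.
  by have [->|_ /eqP //] := eqVneq e' e; rewrite (negPf eNw0).
rewrite (bigD1 e) //= mulrC; congr (_ * _).
  apply: eq_bigr => e' /negPf e'_neq; rewrite /Q e'_neq.
  case: ifP => _; first by apply: eq_bigl => v; rewrite eqb_id.
  rewrite -(sum_weight H p) /cross_prob /perc_prob.
  rewrite [in RHS](bigID (fun v => connect (adj v) (pta H) (ptb H))) /=.
  by rewrite addrAC subrr add0r; apply: eq_bigl => v; rewrite eqbF_neg.
by rewrite /Q eqxx big_pred1_eq.
Qed.

End GluingMeasure.

(** * The transfer operator *)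

Section Transfer.
Variable R : realType.
Implicit Types (G H : ograph) (p : R) (phi psi : {set bool} -> R).

(** The mean operator of the branching process: the expected sum of phi over the
    types of the edges of G, when the marked poles are those in S. *)
Definition transfer G p phi (S : {set bool}) : R :=
  perc_expect p (fun w : {set edge G} => \sum_e phi (anchored S (w :\ e) e)).

Definition seen (S : {set bool}) : R := (S != set0)%:R.

Lemma transfer_subst G H p phi S : pta H != ptb H ->
  transfer (subst_graph G H) p phi S =
  transfer G (cross_prob H p) (transfer H p phi) S.
Proof.
move=> poles_neq; rewrite /transfer /perc_expect.
transitivity (\sum_(W : {set edge (subst_graph G H)}) weight p W *
    \sum_e \sum_f
      phi (anchored (anchored S (coarse W :\ e) e) (fiber W e :\ f) f)).
  apply: eq_bigr => W _; congr (_ * _).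
  rewrite pair_bigA /=; apply: eq_bigr => -[e f] _ /=.
  by rewrite anchored_subst.
under eq_bigr => W _ do rewrite mulr_sumr.
rewrite exchange_big /=.
under [RHS]eq_bigr => w' _ do rewrite mulr_sumr.
rewrite [RHS]exchange_big; apply: eq_bigr => e _ /=.
exact: (perc_subst p e (fun w w0 =>
  \sum_f phi (anchored (anchored S w0 e) (w :\ f) f))).
Qed.

Lemma transfer_single p phi S : transfer single_edge p phi S = phi S.
Proof.
have anchored_single (w : {set edge single_edge}) e :
    anchored S (w :\ e) e = S.
  apply/setP => i; apply/anchoredP/idP => [[j jS]|iS]; last first.
    by exists i => //; case: i {iS}; apply: eq_connect0.
  case/connectP => -[|x p'] /=; first by case: i; case: j jS.
  by case/andP => /adjP[[]]; case: e; rewrite !inE.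
rewrite /transfer /perc_expect (eq_bigr (fun w => weight p w * phi S)).
  by rewrite -mulr_suml sum_weight mul1r.
move=> w _; congr (_ * _); rewrite (eq_bigr (fun=> phi S)) => [|e _].
  by rewrite sumr_const card_unit.
by rewrite anchored_single.
Qed.

Lemma mean_clusterE G p : mean_cluster G p = transfer G p seen setT.
Proof.
apply: eq_bigr => w _; congr (_ * _).
rewrite /seen -natr_sum -sum1_card big_mkcond /=; congr (_%:R).
by apply: eq_bigr => e _; rewrite inE linkedE; case: (_ == _).
Qed.

(** At a fixed point of the crossing probability the same operator acts at each
    generation. *)
Lemma transfer_hier H p k phi S : pta H != ptb H -> cross_prob H p = p ->
  transfer (hier H k) p phi S = iter k (transfer H p) phi S.
Proof.
move=> poles_neq p_fixed; elim: k phi => [|k IHk] phi.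
  exact: transfer_single.
by rewrite /= transfer_subst // p_fixed IHk -iterS iterSr.
Qed.

Lemma transfer_le G p phi psi S : 0 < p < 1 -> (forall S', phi S' <= psi S') ->
  transfer G p phi S <= transfer G p psi S.
Proof.
move=> p01 le_phi; apply: ler_sum => w _; rewrite ler_wpM2l ?weight_ge0 //.
by apply: ler_sum => e _.
Qed.

Lemma transferZ G p (c : R) phi S :
  transfer G p (fun S' => c * phi S') S = c * transfer G p phi S.
Proof.
rewrite mulr_sumr; apply: eq_bigr => w _.
by rewrite -mulr_sumr mulrCA.
Qed.

Lemma transfer0 G p phi : phi set0 = 0 -> transfer G p phi set0 = 0.
Proof.
move=> phi0; apply: big1 => w _; rewrite big1 ?mulr0 // => e _.
by rewrite anchored0.
Qed.

Lemma transfer_mono G p phi : 0 < p < 1 ->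
  {homo phi : S1 S2 / S1 \subset S2 >-> S1 <= S2} ->
  {homo transfer G p phi : S1 S2 / S1 \subset S2 >-> S1 <= S2}.
Proof.
move=> p01 phi_mono S1 S2 S12; apply: ler_sum => w _.
rewrite ler_wpM2l ?weight_ge0 //; apply: ler_sum => e _.
exact/phi_mono/anchoredS.
Qed.

Lemma transfer_le_card G p phi S (c : R) :
  0 < p < 1 -> (forall S', phi S' <= c) ->
  transfer G p phi S <= #|edge G|%:R * c.
Proof.
move=> p01 phi_le.
rewrite -[leRHS]mul1r -{1}(sum_weight G p) mulr_suml.
apply: ler_sum => w _; rewrite ler_wpM2l ?weight_ge0 // mulr_natl -sumr_const.
by apply: ler_sum => e _.
Qed.

(** All weights are positive, so strictness at one edge of one configuration
    suffices. *)
Lemma transfer_lt_card G p phi S (c : R) (w : {set edge G}) f : 0 < p < 1 ->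
  (forall S', phi S' <= c) -> phi (anchored S (w :\ f) f) < c ->
  transfer G p phi S < #|edge G|%:R * c.
Proof.
move=> p01 phi_le phi_lt.
rewrite -[ltRHS]mul1r -{1}(sum_weight G p) mulr_suml /transfer /perc_expect.
rewrite (bigD1 w) // [ltRHS](bigD1 w) //=; apply: ltr_leD.
  rewrite ltr_pM2l ?weight_gt0 // mulr_natl -sumr_const.
  rewrite (bigD1 f) // [ltRHS](bigD1 f) //=; apply: ltr_leD => //.
  by apply: ler_sum => e _.
apply: ler_sum => v _; rewrite ler_wpM2l ?weight_ge0 // mulr_natl -sumr_const.
by apply: ler_sum => e _.
Qed.

End Transfer.

(** * Sequences that are multiplicative up to a constant *)

Section Growth.
Variable R : realType.

(** Fekete: U is submultiplicative and delta U is supermultiplicative. Comparing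
    both at index j k shows that each (delta U_k)^(1/k) is at most each
    U_j^(1/j), and the supremum of the former separates the two families. *)
Lemma quasi_multiplicative_rate (U : nat -> R) (delta : R) :
    0 < delta -> U 0%N = 1 -> (forall k, 0 < U k) ->
    (forall j k, delta * (U j * U k) <= U (j + k)%N <= U j * U k) ->
  exists2 d, 0 < d & forall k, d ^+ k <= U k <= delta^-1 * d ^+ k.
Proof.
move=> delta_gt0 U0 U_gt0 U_mul.
pose lo k := (delta * U k) `^ k%:R^-1; pose up k := U k `^ k%:R^-1.
have rootK (x : R) k : (0 < k)%N -> 0 <= x -> (x `^ k%:R^-1) ^+ k = x.
  move=> k_gt0 x_ge0; rewrite -powR_mulrn ?powR_ge0 // -powRrM mulVf ?powRr1 //.
  by rewrite pnatr_eq0 -lt0n.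
have dU_gt0 k : 0 < delta * U k by rewrite mulr_gt0.
have lo_le_up k j : (0 < k)%N -> (0 < j)%N -> lo k <= up j.
  move=> k_gt0 j_gt0.
  rewrite -(@ler_pXn2r _ (k * j)) ?muln_gt0 ?k_gt0 // ?nnegrE ?powR_ge0 //.
  rewrite exprM rootK ?(ltW (dU_gt0 k)) //.
  rewrite mulnC exprM rootK ?(ltW (U_gt0 j)) //.
  apply: (@le_trans _ _ (U (j * k)%N)).
    elim: j {j_gt0} => [|j IHj]; first by rewrite mul0n U0.
    rewrite exprS mulSn; case/andP: (U_mul k (j * k)%N) => + _.
    by apply: le_trans; rewrite mulrA ler_pM2l.
  elim: k {k_gt0} => [|k IHk]; first by rewrite muln0 U0.
  rewrite exprS mulnS; case/andP: (U_mul j (j * k)%N) => _ /le_trans; apply.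
  by rewrite ler_pM2l.
pose E : R -> Prop := fun x => exists2 k, (0 < k)%N & x = lo k.
have lo_le k : (0 < k)%N -> lo k <= sup E.
  move=> k_gt0; apply: ub_le_sup; last by exists k.
  by exists (up 1%N) => _ [j j_gt0 ->]; apply: lo_le_up.
have le_up k : (0 < k)%N -> sup E <= up k.
  move=> k_gt0; apply: ge_sup; first by exists (lo 1%N), 1%N.
  by move=> _ [j j_gt0 ->]; apply: lo_le_up.
have d_gt0 : 0 < sup E by apply: lt_le_trans (lo_le 1%N isT); apply: powR_gt0.
exists (sup E) => // k; rewrite ler_pdivlMl //.
have [->|k_gt0] := posnP k.
  have := U_mul 0%N 0%N; rewrite addn0 U0 !mulr1 expr0 => /andP[-> _].
  by rewrite lexx.
apply/andP; split.
  rewrite -(rootK (U k) k) ?(ltW (U_gt0 k)) //.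
  by rewrite lerXn2r ?nnegrE ?powR_ge0 ?(ltW d_gt0) ?le_up.
rewrite -(rootK (delta * U k) k) ?(ltW (dU_gt0 k)) //.
by rewrite lerXn2r ?nnegrE ?powR_ge0 ?(ltW d_gt0) ?lo_le.
Qed.

Lemma bernoulli (h : R) k : 0 <= h -> 1 + k%:R * h <= (1 + h) ^+ k.
Proof.
move=> h_ge0; elim: k => [|k IHk]; first by rewrite mul0r addr0.
rewrite exprS; apply: le_trans (ler_wpM2l _ IHk); last by rewrite addr_ge0.
rewrite mulrDl mul1r mulrDr mulr1 -natr1 mulrDl mul1r addrA lerD2l lerDl.
by rewrite mulr_ge0 // mulr_ge0.
Qed.

Lemma exp_le_rate (x d C : R) :
  0 < d -> (forall k, x ^+ k <= C * d ^+ k) -> x <= d.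
Proof.
move=> d_gt0 x_le; rewrite leNgt; apply/negP => d_lt_x.
have C_gt0 : 0 < C.
  by have := x_le 0%N; rewrite !expr0 mulr1; apply: lt_le_trans.
set h := x / d - 1; have h_gt0 : 0 < h by rewrite subr_gt0 ltr_pdivlMr ?mul1r.
have pow_le k : 1 + k%:R * h <= C.
  apply: le_trans (bernoulli k (ltW h_gt0)) _.
  by rewrite addrC subrK expr_div_n ler_pdivrMr ?exprn_gt0.
have Ch_ge0 : 0 <= C / h by rewrite divr_ge0 ?ltW.
have := archi_boundP Ch_ge0; rewrite ltr_pdivrMr // ltNge => /negP[].
by apply: le_trans _ (pow_le (Num.bound (C / h))); rewrite lerDr.
Qed.

End Growth.

(** * Distances in the hierarchical graphs *)

Section Distance.
Variable G : ograph.
Implicit Types (x y z : vert G) (h : vert G -> int).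

Lemma has_walkP x y n :
  reflect (exists s, [/\ path (adj setT) x s, last x s = y & size s = n])
          (has_walk x y n).
Proof.
apply: (iffP existsP) => [[s /andP[xs /eqP ys]]|[s [xs ys /eqP sn]]].
  by exists s; rewrite size_tuple.
by exists (Tuple sn); rewrite /= xs ys eqxx.
Qed.

Lemma has_walk_cat x y z m n :
  has_walk x y m -> has_walk y z n -> has_walk x z (m + n).
Proof.
move=> /has_walkP[s [xs ys <-]] /has_walkP[t [yt zt <-]].
by apply/has_walkP; exists (s ++ t); rewrite cat_path last_cat ys xs size_cat.
Qed.

Lemma has_walk1 x y : has_walk x y 1 = adj setT x y.
Proof.
apply/has_walkP/idP => [[[|z[|z' s]] [//= /andP[xz _] <-]]|xy] //.
by exists [:: y]; rewrite /= xy.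
Qed.

Lemma has_walk_sym x y n : has_walk x y n -> has_walk y x n.
Proof.
case/has_walkP=> s [xs <- <-]; elim: s x xs => [|z s IHs] x /=.
  by move=> _; apply/has_walkP; exists [::].
case/andP=> xz /IHs zs; rewrite -addn1; apply: has_walk_cat zs _.
by rewrite has_walk1 adj_sym.
Qed.

Lemma connect_has_walk x y : connect (adj setT) x y ->
  exists2 n, has_walk x y n & (n < #|vert G|)%N.
Proof.
case/connectP=> p0 + ->; case/shortenP=> p xp p_uniq _.
exists (size p); first by apply/has_walkP; exists p.
by have := max_card (mem (x :: p)); rewrite (card_uniqP p_uniq).
Qed.

Lemma gdist_le x y n : has_walk x y n -> (gdist x y <= n)%N.
Proof.
move=> xyn; rewrite leqNgt; apply/negP => n_lt.
have n_lt_card : (n < #|vert G|)%N.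
  by apply: leq_trans n_lt _; rewrite -[leqRHS](size_iota 0) find_size.
by have := before_find 0%N n_lt; rewrite nth_iota // add0n xyn.
Qed.

Lemma gdist_walk x y : connect (adj setT) x y -> has_walk x y (gdist x y).
Proof.
case/connect_has_walk=> n xyn n_lt.
have has_xy : has (has_walk x y) (iota 0 #|vert G|).
  by apply/hasP; exists n; rewrite // mem_iota.
have := nth_find 0%N has_xy; rewrite nth_iota //.
by rewrite -[ltnRHS](size_iota 0) -has_find.
Qed.

(** Since i takes both values, this bounds the absolute value of the
    difference. *)
Definition lipschitz h := forall e i, h (endp e i) - h (endp e (~~ i)) <= 1.

Lemma lipschitz_walk h x y n :
  lipschitz h -> has_walk x y n -> h y - h x <= n%:Z.
Proof.
move=> h_lip /has_walkP[s [+ <- <-]]; elim: s x => [|z s IHs] x /=.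
  by rewrite subrr.
case/andP=> /adjP[e _ /joinsP[i [-> ->]]] /IHs; set y' := last _ _ => zy.
rewrite -(subrK (h (endp e (~~ i))) (h y')) -addrA -addn1 PoszD lerD //.
by rewrite -{2}(negbK i).
Qed.

(** A walk and a potential certify a distance together. *)
Lemma gdist_eq h x y n :
  lipschitz h -> h y - h x = n%:Z -> has_walk x y n -> gdist x y = n.
Proof.
move=> h_lip hxy xyn; apply/eqP; rewrite eqn_leq gdist_le //=.
have xy : connect (adj setT) x y.
  by case/has_walkP: xyn => s [xs <- _]; apply/connectP; exists s.
by have := lipschitz_walk h_lip (gdist_walk xy); rewrite hxy lez_nat.
Qed.

Lemma gdist_lipschitz x :
  graph_connected G -> lipschitz (fun y => (gdist x y)%:Z).
Proof.
move=> connG e i; rewrite lerBlDr -PoszD lez_nat addnC; apply: gdist_le.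
apply: has_walk_cat (gdist_walk (connG _ _)) _.
rewrite has_walk1; apply/adjP; exists e => //.
by rewrite /joins orbC; apply: joins_endp.
Qed.

Lemma gdist_refl x : gdist x x = 0%N.
Proof.
by apply/eqP; rewrite -leqn0 gdist_le //; apply/has_walkP; exists [::].
Qed.

End Distance.

Section DistanceSubst.
Variables G H : ograph.
Hypothesis poles_neq : pta H != ptb H.
Variable d : nat.

Lemma has_walk_copy e (v v' : vert H) n : has_walk v v' n ->
  has_walk (copy_vert e v : vert (subst_graph G H)) (copy_vert e v') n.
Proof.
case/has_walkP=> s [vs <- <-]; apply/has_walkP.
exists (map (copy_vert e) s); rewrite last_map size_map; split => //.
apply: homo_path vs => x y /adjP[f _ /joinsP[i [-> ->]]].
apply/adjP; exists (e, f) => //.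
by apply/joinsP; exists i; rewrite !endp_subst.
Qed.

Lemma has_walk_subst (x y : vert G) n :
  has_walk (pta H) (ptb H) d -> has_walk x y n ->
  has_walk (inl x : vert (subst_graph G H)) (inl y) (d * n).
Proof.
move=> Hd /has_walkP[s [+ <- <-]]; elim: s x => [|z s IHs] x /=.
  by rewrite muln0 => _; apply/has_walkP; exists [::].
case/andP=> /adjP[e _ /joinsP[i [-> ->]]] /IHs; rewrite mulnS.
apply: has_walk_cat; rewrite -!copy_vert_pole //; apply: has_walk_copy.
by case: i => //=; apply: has_walk_sym.
Qed.

(** If h changes by s in {-1, 0, 1} along e, then d h must change by s d along
    the copy of e. With g = 0 and g = d at the poles of H, the function s g does
    this; its values are integers because s is one. *)
Definition interpolate (h : vert G -> int) (g : vert H -> int)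
    (v : vert (subst_graph G H)) : int :=
  match v with
  | inl x => d%:Z * h x
  | inr (e, u) => d%:Z * h (src e) + (h (tgt e) - h (src e)) * g (val u)
  end.

Lemma interpolate_copy h g e v : g (pta H) = 0 -> g (ptb H) = d%:Z ->
  interpolate h g (copy_vert e v) =
  d%:Z * h (src e) + (h (tgt e) - h (src e)) * g v.
Proof.
move=> g_a g_b; have [[u ->]|[i ->]] := innerP v.
  by rewrite copy_vert_inner.
rewrite copy_vert_pole //; case: i => /=; first by rewrite g_b; ring.
by rewrite g_a; ring.
Qed.

Lemma interpolate_lipschitz h g : g (pta H) = 0 -> g (ptb H) = d%:Z ->
  lipschitz h -> lipschitz g -> lipschitz (interpolate h g).
Proof.
move=> g_a g_b h_lip g_lip [e f] i; rewrite !endp_subst !interpolate_copy //.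
have /= := h_lip e true; have /= := h_lip e false; rewrite /endp /=.
have := g_lip f (~~ i); have := g_lip f i; rewrite negbK.
move: (g _) (g _) (h _) (h _) => x y s t; nia.
Qed.
End DistanceSubst.

Lemma gdist_hier (H : ograph) k : graph_connected H -> pta H != ptb H ->
  gdist (pta (hier H k)) (ptb (hier H k)) = (gdist (pta H) (ptb H) ^ k)%N.
Proof.
move=> connH poles_neq; set d := gdist (pta H) (ptb H).
pose g v := (gdist (pta H) v)%:Z.
have [h [h_lip h_a h_b ab]] : exists h : vert (hier H k) -> int,
    [/\ lipschitz h, h (pta _) = 0, h (ptb _) = (d ^ k)%N%:Z
      & has_walk (pta (hier H k)) (ptb (hier H k)) (d ^ k)].
  elim: k => [|k [h [h_lip h_a h_b ab]]].
    exists (fun x : bool => (nat_of_bool x)%:Z).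
    split=> //; first by move=> e [].
    by rewrite expn0 has_walk1; apply/adjP; exists tt.
  exists (interpolate d h g); split.
  - apply: interpolate_lipschitz => //; first by rewrite /g gdist_refl.
    exact: gdist_lipschitz.
  - by rewrite /= h_a mulr0.
  - by rewrite /= h_b expnS PoszM.
  - by rewrite expnS; apply: has_walk_subst => //; apply: gdist_walk.
by apply: gdist_eq h_lip _ ab; rewrite h_a h_b subr0.
Qed.

(** * One step in the base graph *)

Section BaseGraph.
Variable G : ograph.
Implicit Types (x y z : vert G) (e f : edge G) (w : {set edge G}).

Lemma gdist_gt1 x y : (1 < gdist x y)%N -> x != y /\ ~~ adj setT x y.
Proof.
move=> dist_gt1; split; move: dist_gt1.
  by apply: contraTneq => ->; rewrite gdist_refl.
apply: contraL => xy.
by rewrite -leqNgt gdist_le // has_walk1.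
Qed.

Lemma connect_set0 x y : connect (adj set0) x y -> x = y.
Proof.
case/connectP => -[|z p] //=.
by case/andP=> /adjP[e]; rewrite in_set0.
Qed.

Lemma walk_connect w x (s : seq (edge G * vert G)) :
  walk x s -> {subset unzip1 s <= w} -> connect (adj w) x (last x (unzip2 s)).
Proof.
elim: s x => [|[e y] s IHs] x /=; first by rewrite connect0.
case/andP=> xy ys sw; apply: (@connect_trans _ _ y).
  by apply: connect1; apply/adjP; exists e => //; apply: sw; rewrite mem_head.
by apply: IHs => // f fs; apply: sw; rewrite inE fs orbT.
Qed.

Lemma edge_disjoint_connect x y : two_edge_disjoint_paths x y ->
  exists w1 w2, [/\ [disjoint w1 & w2], connect (adj w1) x y
                  & connect (adj w2) x y].
Proof.
case=> s1 [s2 [/and3P[xs1 /eqP s1y _] /and3P[xs2 /eqP s2y _] s12]].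
exists [set e in unzip1 s1], [set e in unzip1 s2]; split.
- rewrite disjoint_sym disjoint_subset; apply/subsetP=> e; rewrite !inE => es2.
  by apply: contra s12 => es1; apply/hasP; exists e.
- by rewrite -s1y; apply: walk_connect => // e; rewrite inE.
- by rewrite -s2y; apply: walk_connect => // e; rewrite inE.
Qed.

(** A path without repeated vertices visits y only at its end, so it does not
    use its last edge before. *)
Lemma last_edge w x y : x != y -> connect (adj w) x y ->
  exists f i, [/\ f \in w, endp f i = y
                & connect (adj (w :\ f)) x (endp f (~~ i))].
Proof.
move=> + /connectP[p0 xp0 yE]; rewrite {}yE.
case/shortenP: xp0 => p xp p_uniq _ {p0}.
case/lastP: p xp p_uniq => [|p z]; first by rewrite /= eqxx.
rewrite last_rcons rcons_path -rcons_cons rcons_uniq.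
case/andP=> xp /adjP[f fw /joinsP[i [pE zE]]] /andP[zNp _] _.
exists f, (~~ i); split=> //; rewrite negbK -pE.
apply/connectP; exists p => //.
apply: (sub_in_path (P := [pred t | t != z])) xp => [u t|]; last first.
  by apply/allP => t tp; apply: contraNneq zNp => <-.
rewrite !inE => u_neq t_neq /adjP[e ew ut]; apply/adjP; exists e => //.
rewrite in_setD1 ew andbT; apply: contraNneq u_neq => ef.
move: ut t_neq; rewrite zE ef => /joinsP[j [-> ->]].
by case: i {pE zE}; case: j => //=; rewrite eqxx.
Qed.

Hypothesis simpleG : oriented_simple G.

Lemma endp_inj e i j : endp e i = endp e j -> i = j.
Proof.
have [/(_ e) e_neq _] := simpleG.
by case: i; case: j => // /eqP;
   rewrite /endp /= ?[tgt e == _]eq_sym (negPf e_neq).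
Qed.

Hypothesis distG : (1 < gdist (pta G) (ptb G))%N.
Hypothesis pathsG : two_edge_disjoint_paths (pta G) (ptb G).

(** The last edge f of a path from pole i to the opposite pole. Its far end is
    reached by the second path, which is edge-disjoint from the first, and its
    near end by the rest of the first path. It does not touch pole i because the
    poles are not adjacent. *)
Lemma far_edge i : exists f i0,
  [/\ endp f i0 = pole G (~~ i), forall j, endp f j != pole G i
    & anchored [set i] (setT :\ f) f = setT].
Proof.
have [ab_neq ab_nadj] := gdist_gt1 distG.
have pole_neq : pole G i != pole G (~~ i) by case: (i); rewrite // eq_sym.
have pole_nadj : ~~ adj setT (pole G i) (pole G (~~ i)).
  by case: (i); rewrite // adj_sym.
have [w1 [w2 [w12 ab1 ab2]]] := edge_disjoint_connect pathsG.
have poles_connect w : connect (adj w) (pta G) (ptb G) ->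
    connect (adj w) (pole G i) (pole G (~~ i)).
  by case: (i); rewrite // connectC.
have [f [i0 [fw1 fi0 iv]]] := last_edge pole_neq (poles_connect _ ab1).
have f_far j : endp f j != pole G i.
  have [<-|/bool_neq ->] := eqVneq i0 j; first by rewrite fi0 eq_sym.
  apply: contraNneq pole_nadj => <-; rewrite -fi0; apply/adjP; exists f => //.
  by rewrite -{2}(negbK i0); apply: joins_endp.
exists f, i0; split=> //; apply/setP => j; rewrite in_setT; apply/anchoredP.
exists i; first by rewrite set11.
rewrite connectC; have [<-|/bool_neq ->] := eqVneq i0 j.
  rewrite fi0; apply: connect_subset (poles_connect _ ab2).
  by rewrite subsetD1 subsetT (disjointFr w12).
by apply: connect_subset iv; apply: setSD; apply: subsetT.
Qed.

Section BaseTransfer.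
Variables (R : realType) (p : R).
Hypothesis p01 : 0 < p < 1.

Definition pole_deg i j : nat := #|[set e | endp e j == pole G i]|.

(** The first two terms count the edges at the marked pole, which have it as an
    end whatever the configuration; the third one is the contribution of the
    edge of [far_edge] when all edges are open. *)
Lemma transfer_set1_ge (phi : {set bool} -> R) i :
  (forall S, 0 <= phi S) ->
  {homo phi : S1 S2 / S1 \subset S2 >-> S1 <= S2} ->
  (pole_deg i false)%:R * phi [set false] +
    (pole_deg i true)%:R * phi [set true] + weight p [set: edge G] * phi setT
  <= transfer G p phi [set i].
Proof.
move=> phi_ge0 phi_mono; have [f [_ [_ f_far f_anch]]] := far_edge i.
pose D j e : R := (endp e j == pole G i)%:R * phi [set j].
have sumD j : \sum_e D j e = (pole_deg i j)%:R * phi [set j].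
  rewrite -mulr_suml -natr_sum /pole_deg -sum1_card; congr (_%:R * _).
  rewrite [RHS]big_mkcond /=; apply: eq_bigr => e _; rewrite inE.
  by case: (_ == _).
have D_le w e : D false e + D true e <= phi (anchored [set i] (w :\ e) e).
  have D_anch j : endp e j = pole G i ->
      phi [set j] <= phi (anchored [set i] (w :\ e) e).
    move=> ej; apply: phi_mono; rewrite sub1set; apply/anchoredP.
    by exists i; rewrite ?set11 // ej connect0.
  rewrite /D; case: eqP => [e0|_]; case: eqP => [e1|_].
  - by have := endp_inj (etrans e0 (esym e1)).
  - by rewrite mul1r mul0r addr0 D_anch.
  - by rewrite mul1r mul0r add0r D_anch.
  - by rewrite !mul0r addr0.
have key w : \sum_e (D false e + D true e) + (w == setT)%:R * phi setT <=
    \sum_e phi (anchored [set i] (w :\ e) e).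
  rewrite (bigD1 f) // [leRHS](bigD1 f) //= addrAC lerD ?ler_sum //.
  rewrite /D !(negPf (f_far _)) !mul0r !add0r.
  by case: eqP => [->|_]; rewrite ?f_anch ?mul1r ?mul0r.
rewrite -!sumD -big_split /=.
have -> : weight p [set: edge G] * phi setT =
    \sum_w weight p w * ((w == [set: edge G])%:R * phi setT).
  rewrite (bigD1 [set: edge G]) //= eqxx mul1r big1 ?addr0 // => w /negPf ->.
  by rewrite mul0r mulr0.
rewrite -[X in X + _]mul1r -{1}(sum_weight G p) mulr_suml -big_split /=.
by apply: ler_sum => w _; rewrite -mulrDr ler_wpM2l ?weight_ge0.
Qed.

End BaseTransfer.
End BaseGraph.

(** * Growth of the mean cluster size *)

Section Iteration.
Variables (R : realType) (G : ograph) (p : R).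
Hypothesis p01 : 0 < p < 1.
Implicit Types (phi : {set bool} -> R) (S : {set bool}).

Lemma iter_transfer_le phi c k : (forall S, phi S <= c * seen R S) ->
  forall S, iter k (transfer G p) phi S <= c * iter k (transfer G p) (seen R) S.
Proof.
move=> phi_le; elim: k => [|k IHk] S //=.
by rewrite -transferZ; apply: transfer_le.
Qed.

Lemma iter_transfer_ge phi c k : (forall S, c * seen R S <= phi S) ->
  forall S, c * iter k (transfer G p) (seen R) S <= iter k (transfer G p) phi S.
Proof.
move=> phi_ge; elim: k => [|k IHk] S //=.
by rewrite -transferZ; apply: transfer_le.
Qed.

Lemma seen_mono : {homo @seen R : S1 S2 / S1 \subset S2 >-> S1 <= S2}.
Proof.
move=> S1 S2 S12; rewrite /seen ler_nat.
have [//|/set0Pn[i iS1]] := eqVneq S1 set0.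
by have -> : S2 != set0 by apply/set0Pn; exists i; apply: (subsetP S12).
Qed.

(** At a fixed point of the crossing probability, this is the mean number of
    edges of the k-th hierarchical graph connected to the poles in S. *)
Definition mean_seen k : {set bool} -> R := iter k (transfer G p) (seen R).

Lemma mean_seen_mono k :
  {homo mean_seen k : S1 S2 / S1 \subset S2 >-> S1 <= S2}.
Proof.
by elim: k => [|k IHk]; [apply: seen_mono|apply: transfer_mono].
Qed.

Lemma mean_seen_set0 k : mean_seen k set0 = 0.
Proof.
elim: k => [|k IHk]; first by rewrite /mean_seen /= /seen eqxx.
exact: transfer0.
Qed.

Lemma mean_seen_ge0 k S : 0 <= mean_seen k S.
Proof. by rewrite -(mean_seen_set0 k); apply/mean_seen_mono/sub0set. Qed.

Lemma mean_seen_le_topM k S : mean_seen k S <= mean_seen k setT * seen R S.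
Proof.
rewrite /seen; have [->|_] := eqVneq S set0.
  by rewrite mean_seen_set0 mulr0.
by rewrite mulr1; apply/mean_seen_mono/subsetT.
Qed.

Lemma mean_seen_topM j k :
  mean_seen (j + k) setT <= mean_seen j setT * mean_seen k setT.
Proof.
rewrite /mean_seen iterD mulrC; apply: iter_transfer_le => S.
exact: mean_seen_le_topM.
Qed.

Lemma mean_seen_card k : mean_seen k setT <= #|edge G|%:R ^+ k.
Proof.
elim: k => [|k IHk]; first by rewrite expr0 /mean_seen /= /seen lern1 leq_b1.
rewrite exprS; apply: (@le_trans _ _ (#|edge G|%:R * mean_seen k setT)).
  by apply: transfer_le_card => // S; apply/mean_seen_mono/subsetT.
by rewrite ler_wpM2l.
Qed.

End Iteration.

Section Rate.
Variables (R : realType) (G : ograph) (p : R).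
Hypothesis simpleG : oriented_simple G.
Hypothesis distG : (1 < gdist (pta G) (ptb G))%N.
Hypothesis pathsG : two_edge_disjoint_paths (pta G) (ptb G).
Hypothesis p01 : 0 < p < 1.

Local Notation U k := (mean_seen G p k setT).
Local Notation u k i := (mean_seen G p k [set i]).
Local Notation eps := (weight p [set: edge G]).

Lemma mean_seen0_set1 i : u 0 i = 1.
Proof.
rewrite /mean_seen /= /seen; have -> // : [set i] != set0.
by apply/set0Pn; exists i; rewrite set11.
Qed.

Lemma mean_seen_step k i :
  (pole_deg G i false)%:R * u k false + (pole_deg G i true)%:R * u k true
    + eps * U k <= u k.+1 i.
Proof.
apply: (transfer_set1_ge simpleG distG pathsG p01).
  by move=> S; apply: mean_seen_ge0.
exact: mean_seen_mono.
Qed.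

Lemma mean_seen_step_top k i : eps * U k <= u k.+1 i.
Proof.
apply: le_trans (mean_seen_step k i); rewrite lerDr.
by rewrite addr_ge0 // mulr_ge0 // mean_seen_ge0.
Qed.

Lemma mean_seen_le_top k i : u k i <= U k.
Proof. exact/mean_seen_mono/subsetT. Qed.

Lemma mean_seen_top_gt0 k : 0 < U k.
Proof.
elim: k => [|k IHk].
  rewrite /mean_seen /= /seen -card_gt0 cardsT card_bool ltr01 //.
apply: lt_le_trans (mean_seen_le_top k.+1 true).
by apply: lt_le_trans (mean_seen_step_top k true); rewrite mulr_gt0 ?weight_gt0.
Qed.

Lemma edges_gt0 : 0 < #|edge G|%:R :> R.
Proof.
have [f _] := far_edge distG pathsG true.
by rewrite ltr0n; apply/card_gt0P; exists f.
Qed.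

(** A lower bound for the share of U_k that is seen from one pole alone. *)
Definition isotropy : R := eps / #|edge G|%:R.

Lemma isotropy_gt0 : 0 < isotropy.
Proof. by rewrite divr_gt0 ?weight_gt0 ?edges_gt0. Qed.

(** The first step from a single pole yields, with probability at least eps, an
    edge of full type, whereas a first step from both poles yields at most as
    many edges of full type as G has edges. *)
Lemma mean_seen_isotropy k i : isotropy * U k <= u k i.
Proof.
rewrite /isotropy mulrAC ler_pdivrMr ?edges_gt0 //.
case: k => [|k].
  apply: le_trans (mean_seen_step_top 0 i) _.
  apply: le_trans (mean_seen_le_top 1 i) _.
  by rewrite mean_seen0_set1 mul1r -[leRHS]expr1 mean_seen_card.
apply: le_trans (ler_wpM2r _ (mean_seen_step_top k i));
  last exact: ltW edges_gt0.
rewrite -mulrA ler_wpM2l ?weight_ge0 // mulrC; apply: transfer_le_card => // S.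
exact/mean_seen_mono/subsetT.
Qed.

Lemma mean_seen_topM_ge j k : isotropy * (U j * U k) <= U (j + k)%N.
Proof.
rewrite mulrCA [leLHS]mulrC {3}/mean_seen iterD.
apply: iter_transfer_ge => // S.
rewrite /seen; case: (set_0Vmem S) => [->|[i iS]].
  by rewrite eqxx mulr0 mean_seen_ge0.
have -> : S != set0 by apply/set0Pn; exists i.
rewrite mulr1; apply: le_trans (mean_seen_isotropy k i) _.
by apply: mean_seen_mono; rewrite // sub1set.
Qed.

(** With all edges closed, an edge that does not touch pole i is not linked
    to it. *)
Lemma mean_seen1_lt i : mean_seen G p 1 [set i] < #|edge G|%:R.
Proof.
have [f [i0 [_ f_far _]]] := far_edge distG pathsG i.
rewrite -[ltRHS]mulr1; apply: (transfer_lt_card (w := set0) (f := f)) => //.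
  by move=> S; rewrite /mean_seen /= /seen lern1 leq_b1.
rewrite /mean_seen /= /seen (_ : anchored _ _ _ = set0) ?eqxx //.
apply/setP => j; rewrite in_set0; apply/anchoredP => -[j' /set1P ->].
by rewrite set0D => /connect_set0/eqP; rewrite (negPf (f_far j)).
Qed.

(** One generation is not enough: in the 4-cycle with opposite poles, every edge
    touches a pole and U_1 is the number of edges. With all edges closed, the
    edge f below has only one marked end, and not all of its descendants are
    linked. *)
Lemma mean_seen2_lt : U 2 < #|edge G|%:R ^+ 2.
Proof.
have [f [i0 [fi0 f_far _]]] := far_edge distG pathsG true.
rewrite expr2; apply: (transfer_lt_card (w := set0) (f := f)) => //.
  move=> S; rewrite -[leRHS]expr1; apply: le_trans _ (mean_seen_card G p01 1).
  exact: (@mean_seen_mono _ G _ p01 1 S setT (subsetT S)).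
apply: le_lt_trans (mean_seen1_lt i0).
apply: (@mean_seen_mono _ G _ p01 1) => //.
apply/subsetP=> j /anchoredP[j' _]; rewrite set0D => /connect_set0.
case: j' => end_j; first by have := f_far j; rewrite end_j eqxx.
by rewrite (endp_inj simpleG (etrans end_j (esym fi0))) set11.
Qed.

Section Exponent.
Variable d : R.
Hypothesis d_gt0 : 0 < d.
Hypothesis d_rate :
  forall k, d ^+ k <= U k <= isotropy^-1 * d ^+ k.

Lemma rate_lt_card : d < #|edge G|%:R.
Proof.
rewrite -(@ltr_pXn2r _ 2) ?nnegrE ?ltW ?edges_gt0 //.
by case/andP: (d_rate 2) => /le_lt_trans + _; apply; apply: mean_seen2_lt.
Qed.

(** The gain eps at each step is what makes the inequality strict. *)
Lemma rate_gt (D : nat) (v : nat -> R) :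
  v 0%N = 1 -> (forall k, v k <= U k) ->
  (forall k, (D%:R + eps) * v k <= v k.+1) -> D%:R < d.
Proof.
move=> v0 v_le v_step.
apply: (@lt_le_trans _ _ (D%:R + eps)); first by rewrite ltrDl weight_gt0.
apply: (@exp_le_rate _ _ _ isotropy^-1) => // k.
have: (D%:R + eps) ^+ k <= v k.
  elim: k => [|k IHk]; first by rewrite expr0 v0.
  rewrite exprS; apply: le_trans (v_step k); rewrite ler_wpM2l //.
  by rewrite addr_ge0 // weight_ge0.
move=> /le_trans; apply; apply: le_trans (v_le k) _.
by case/andP: (d_rate k).
Qed.

(** If pole i is marked, the edges that have it as their end i have a type
    containing i, and so have at least the descendants of the type [set i]. *)
Lemma rate_gt_pole_deg i : (pole_deg G i i)%:R < d.
Proof.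
apply: (@rate_gt _ (fun k => u k i)) => [|k|k]; first exact: mean_seen0_set1.
  exact: mean_seen_le_top.
apply: le_trans (mean_seen_step k i); rewrite mulrDl.
apply: lerD; last by rewrite ler_wpM2l ?mean_seen_le_top // weight_ge0.
by case: i; rewrite ?lerDl ?lerDr mulr_ge0 // mean_seen_ge0.
Qed.

(** Each edge at a pole has exactly one end there, but not always the same one;
    the minimum of the two counts grows at least by the smaller degree. *)
Lemma rate_gt_min : (minn (deg (pta G)) (deg (ptb G)))%:R < d.
Proof.
apply: (@rate_gt _ (fun k => Num.min (u k false) (u k true))) => [|k|k].
- by rewrite !mean_seen0_set1 minxx.
- by rewrite ge_min mean_seen_le_top.
set m := Num.min _ _.
have m_le i : m <= u k i by case: i; rewrite ge_min lexx ?orbT.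
have m_ge0 : 0 <= m by rewrite le_min !mean_seen_ge0.
suff step i : ((minn (deg (pta G)) (deg (ptb G)))%:R + eps) * m <= u k.+1 i.
  by rewrite le_min !step.
apply: le_trans (mean_seen_step k i); rewrite mulrDl; apply: lerD; last first.
  by rewrite ler_wpM2l ?weight_ge0 // (le_trans (m_le i)) // mean_seen_le_top.
apply: (@le_trans _ _ ((pole_deg G i false + pole_deg G i true)%:R * m)).
  rewrite ler_wpM2r // ler_nat.
  by case: i; [apply: geq_minr|apply: geq_minl].
by rewrite natrD mulrDl; apply: lerD; apply: ler_wpM2l.
Qed.

End Exponent.

Lemma mean_seen_rate : exists2 d, 0 < d &
  [/\ forall k, d ^+ k <= U k <= isotropy^-1 * d ^+ k,
      d < #|edge G|%:R
    & (maxn (deg_out (pta G))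
           (maxn (deg_in (ptb G))
              (minn (deg (pta G)) (deg (ptb G)))))%:R < d].
Proof.
have [|k|j k|d d_gt0 d_rate] :=
    @quasi_multiplicative_rate _ (fun k => U k) isotropy isotropy_gt0.
- by rewrite /mean_seen /= /seen -card_gt0 cardsT card_bool.
- exact: mean_seen_top_gt0.
- by rewrite mean_seen_topM_ge mean_seen_topM.
exists d => //; split=> //; first exact: rate_lt_card.
have max_lt m n : m%:R < d -> n%:R < d -> (maxn m n)%:R < d.
  by rewrite /maxn; case: ifP.
apply: (max_lt); first exact: (rate_gt_pole_deg d_gt0 d_rate false).
apply: (max_lt); first exact: (rate_gt_pole_deg d_gt0 d_rate true).
exact: rate_gt_min.
Qed.

End Rate.

(** * From the rate to the theorem *)

Lemma card_edge_hier (H : ograph) k : #|edge (hier H k)| = (#|edge H| ^ k)%N.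
Proof.
elim: k => [|k IHk]; first by rewrite card_unit.
by rewrite card_prod IHk expnSr.
Qed.

Lemma unif_linkedE (R : realType) (G : ograph) (p : R) :
  unif_linked_prob G p = mean_cluster G p / #|edge G|%:R.
Proof.
rewrite /unif_linked_prob /edge_perc_prob -mulr_sumr mulrC; congr (_ / _).
rewrite big_mkcond.
rewrite -(pair_bigA _ (fun e w => if linked w e then weight p w else 0)).
rewrite exchange_big; apply: eq_bigr => w _ /=.
rewrite -big_mkcond sumr_const mulr_natr; congr (_ *+ _).
by apply: eq_card => e; rewrite !inE.
Qed.

Theorem theorem7p1 (R : realType) (G1 : ograph) (pstar : R)
  (G1_simple : oriented_simple G1)
  (G1_connected : graph_connected G1)
  (G1_dist : (1 < gdist (pta G1) (ptb G1))%N)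
  (G1_paths : two_edge_disjoint_paths (pta G1) (ptb G1))
  (pstar01 : 0 < pstar < 1)
  (pstar_fixed : cross_prob G1 pstar = pstar) :
  exists df c C : R,
    [/\ 0 < c, 0 < C,
        forall k : nat,
          c * df ^+ k <= mean_cluster (hier G1 k) pstar <= C * df ^+ k,
        df < #|edge G1|%:R /\
        (maxn (deg_out (pta G1))
           (maxn (deg_in (ptb G1))
              (minn (deg (pta G1)) (deg (ptb G1)))))%:R < df
      & let alpha1 := ln (#|edge G1|%:R / df)
                      / ln (gdist (pta G1) (ptb G1))%:R in
        forall k : nat,
          let dk := (gdist (pta (hier G1 k)) (ptb (hier G1 k)))%:R : R in
          c * dk `^ (- alpha1)
            <= unif_linked_prob (hier G1 k) pstar
            <= C * dk `^ (- alpha1)].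
Proof.
have [poles_neq _] := gdist_gt1 G1_dist.
have [d d_gt0 [d_rate d_lt d_gt]] :=
  mean_seen_rate G1_simple G1_dist G1_paths pstar01.
set delta := isotropy G1 pstar in d_rate.
have meanE k : mean_cluster (hier G1 k) pstar = mean_seen G1 pstar k setT.
  by rewrite mean_clusterE transfer_hier.
exists d, 1, delta^-1; split => //.
- by rewrite invr_gt0 isotropy_gt0.
- by move=> k; rewrite mul1r meanE.
set E := #|edge G1|%:R in d_lt *; move=> alpha1 k; cbv zeta.
have E_gt0 : 0 < E by apply: lt_trans d_lt.
have ln_gt0 : 0 < ln (gdist (pta G1) (ptb G1))%:R :> R.
  by rewrite ln_gt0 // ltr1n.
have -> : (gdist (pta (hier G1 k)) (ptb (hier G1 k)))%:R `^ (- alpha1) =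
    (d / E) ^+ k.
  rewrite gdist_hier // natrX -powR_mulrn // -powRrM mulrC powRrM.
  rewrite -(@powR_mulrn _ (d / E)) ?divr_ge0 ?ltW //; congr (_ `^ _).
  rewrite /powR pnatr_eq0 gtn_eqF ?(ltnW G1_dist) // mulNr divfK ?gt_eqF //.
  by rewrite -lnV ?posrE ?divr_gt0 // invf_div lnK // posrE divr_gt0.
rewrite unif_linkedE meanE card_edge_hier natrX -/E expr_div_n !mulrA mul1r.
case/andP: (d_rate k) => lo up.
by rewrite !ler_pM2r ?invr_gt0 ?exprn_gt0 // lo.
Qed.
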